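(* For every non-negative integer $n$ there exist integers $x,y,z,t$ with $$P_8(x)+P_8(y)+3P_8(z)+3P_8(t)=n,$$ where $P_8(x)=3x^2-2x$. That is, the sum $\Phi_{1,1,3,3}$ of generalized octagonal numbers is universal over $\mathbb{Z}$.
   Context: A generalized octagonal number is an integer of the form $P_8(x)=3x^2-2x$ with $x\in\mathbb{Z}$. For positive integers $a_1,\dots,a_k$, $\Phi_{a_1,\dots,a_k}(x_1,\dots,x_k)=a_1P_8(x_1)+\cdots+a_kP_8(x_k)$; it is called universal over $\mathbb{Z}$ if the equation $\Phi_{a_1,\dots,a_k}(x_1,\dots,x_k)=n$ has an integer solution for every non-negative integer $n$. *)

(* Defs.v *)
From mathcomp Require Import all_boot all_order all_algebra.

Set Implicit Arguments.
Unset Strict Implicit.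
Unset Printing Implicit Defensive.

Import Order.TTheory GRing.Theory Num.Theory.

Local Open Scope ring_scope.

Definition P8 (x : int) : int := 3 * x ^+ 2 - 2 * x.

(* The coefficients [a] are meant to be positive, as they are in every use. *)
Definition Phi (k : nat) (a : k.-tuple nat) (x : k.-tuple int) : int :=
  \sum_(i < k) (tnth a i)%:Z * P8 (tnth x i).

Definition universal (k : nat) (a : k.-tuple nat) : Prop :=
  forall n : nat, exists x : k.-tuple int, Phi a x = n%:Z.

(* Main.v *)
Require Import Defs.
From mathcomp Require Import all_boot all_order all_algebra.
From mathcomp Require Import zify ring.

Set Implicit Arguments.
Unset Strict Implicit.
Unset Printing Implicit Defensive.

Import Order.TTheory GRing.Theory Num.Theory.

Local Open Scope ring_scope.

(* Since 3 P8(a) + 1 = (3a - 1)^2, one has to write N = 3n + 8 as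
   x^2 + 3 z^2 + y^2 + 3 t^2 with z and t prime to 3 (x and y then are, as
   N = 2 mod 3).  A descent in a norm-Euclidean order of the quaternion algebra
   (-1, -3) shows that every N > 0 has the form |p|^2 + |q|^2 with
   p = x + z sqrt(-3) and q = y + t sqrt(-3).
   If p is divisible by 2 among the Eisenstein integers, multiplying it by a
   cube root of unity keeps integer coordinates and shifts z mod 3 at will, so
   p is harmless.  Exchanging z and t moves the parity obstruction from one
   summand to the other, and alternating both operations is a descent for the
   2-adic valuation of q that can only fail to terminate well when N = 2 X^2 or
   N = 5 X^2.  There X > 1, and unless X is a square (which reduces to a smaller
   X) it has a representation a^2 + b^2 + 3 (c^2 + d^2) with (c, d) != (0, 0),
   which yields a different starting point for the descent. *)

(** * The form [x ^ 2 + 3 * z ^ 2] modulo 2 and 3, and its turns by roots of unity *)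

Definition eis (x z : int) : int := x ^+ 2 + 3 * z ^+ 2.

Definition good (N : int) : Prop := exists x z y t : int,
  [/\ eis x z + eis y t = N, ~~ (3 %| z)%Z & ~~ (3 %| t)%Z].

Lemma eis_mod3 (x z : int) :
  (eis x z %% 3)%Z = 0 /\ (3 %| x)%Z \/ (eis x z %% 3)%Z = 1 /\ ~~ (3 %| x)%Z.
Proof.
rewrite /eis; have [/dvdzP[q ->]|h] := boolP (3 %| x)%Z; first by left; lia.
have [q [->|->]] : exists q, x = 3 * q + 1 \/ x = 3 * q - 1.
  by exists ((x + 1) %/ 3)%Z; lia.
- by right; lia.
- by right; lia.
Qed.

Lemma sum_eis_mod3 (x z y t : int) :
  ((eis x z + eis y t) %% 3 = 2)%Z -> ~~ (3 %| x)%Z /\ ~~ (3 %| y)%Z.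
Proof. by have := eis_mod3 x z; have := eis_mod3 y t; lia. Qed.

(** Multiplication of [(2 * a - z) + z sqrt(-3)] by a primitive cube root of unity, up to the sign
    of the first coordinate. *)
Lemma eis_turn (a z : int) : eis (2 * a - z) z = eis (a + z) (a - z).
Proof. by rewrite /eis; ring. Qed.

(** A sixth root of unity times [2 (u + v sqrt(-3))], up to sign; the result is integral whatever
    the parity of [u + v]. *)
Lemma eis_turn2 (u v : int) : eis (2 * u) (2 * v) = eis (u + 3 * v) (u - v).
Proof. by rewrite /eis; ring. Qed.

Lemma eis_turn2N (u v : int) : eis (2 * u) (2 * v) = eis (u - 3 * v) (u + v).
Proof. by rewrite /eis; ring. Qed.

Lemma even_subr (x z : int) : (2 %| x + z)%Z -> exists a, x = 2 * a - z.
Proof. by move=> h; exists ((x + z) %/ 2)%Z; lia. Qed.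

(* When x + z sqrt(-3) is divisible by 2 among the Eisenstein integers, its
   products with the three cube roots of unity have integer coordinates. *)
Lemma eis_residue (r x z : int) : (2 %| x + z)%Z -> ~~ (3 %| x)%Z ->
  exists x' z', [/\ eis x' z' = eis x z, ~~ (3 %| x')%Z & (3 %| z' - r)%Z].
Proof.
move=> /even_subr[a ->] hx.
have [h|h] := boolP (3 %| z - r)%Z; first by exists (2 * a - z), z.
have [h1|h1] := boolP (3 %| a - z - r)%Z.
  by exists (a + z), (a - z); rewrite eis_turn; split=> //; lia.
by exists (2 * z - a), (- a); split; [rewrite /eis; ring | lia | lia].
Qed.

(** Up to sign, the three turns have second coordinates [b], [a - b] and [a], one of which is
    even. *)
Lemma eis_even (y t : int) : (2 %| y + t)%Z ->
  exists u v, eis y t = eis (2 * u) (2 * v).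
Proof.
move=> h; have [a [b [hy ht]]] : exists a b, y = 2 * a - b /\ t = b.
  by have [a] := even_subr h; exists a, t.
subst y t; have [hb|hb] := boolP (2 %| b)%Z.
  have [c ->] : exists c, b = 2 * c by exists (b %/ 2)%Z; lia.
  by exists (a - c), c; congr eis; ring.
have [ha|ha] := boolP (2 %| a)%Z.
  have [c ->] : exists c, a = 2 * c by exists (a %/ 2)%Z; lia.
  by exists (b - c), c; rewrite /eis; ring.
have [c ->] : exists c, a = 2 * c + b by exists ((a - b) %/ 2)%Z; lia.
by exists (c + b), c; rewrite /eis; ring.
Qed.

Lemma good_odd (x z y t : int) : ((eis x z + eis y t) %% 3 = 2)%Z ->
  ~~ (3 %| z)%Z -> (2 %| y + t)%Z -> good (eis x z + eis y t).
Proof.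
move=> h hz hyt; have [_ hy] := sum_eis_mod3 h.
have [y' [t' [e _ ht']]] := eis_residue 1 hyt hy.
by exists x, z, y', t'; rewrite e; split=> //; lia.
Qed.

Lemma eis_swap (x z y t : int) : eis x z + eis y t = eis x t + eis y z.
Proof. by rewrite /eis; ring. Qed.

Lemma good_scale (m N : int) : ~~ (3 %| m)%Z -> good N -> good (m ^+ 2 * N).
Proof.
move=> hm [x [z [y [t [<- hz ht]]]]].
exists (m * x), (m * z), (m * y), (m * t); split; first by rewrite /eis; ring.
  by rewrite Gauss_dvdzr // coprimezE /= prime_coprime //; lia.
by rewrite Gauss_dvdzr // coprimezE /= prime_coprime //; lia.
Qed.

Lemma good_even (x z y t : int) : ((eis x z + eis y t) %% 3 = 2)%Z ->
  (2 %| x + z)%Z -> (2 %| y + t)%Z -> good (eis x z + eis y t).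
Proof.
move=> h hxz hyt; have [hx _] := sum_eis_mod3 h.
have [x' [z' [e _ hz']]] := eis_residue 1 hxz hx.
by rewrite -e; apply: good_odd => //; [rewrite e | lia].
Qed.

(** * 2-adic descent for odd sums *)

(* [divpow k u v] says that [2 ^ k] divides [u + v * sqrt (-3)] among the
   Eisenstein integers. *)
Definition divpow (k : nat) (u v : int) : bool :=
  (2 ^+ k %| u + v)%Z && (2 ^+ k %| 2 * v)%Z.

Lemma divpow0 (u v : int) : divpow 0 u v.
Proof. by rewrite /divpow expr0 !dvd1z. Qed.

Lemma divpowS (k : nat) (a v : int) :
  divpow k.+1 (2 * a - v) v = (2 ^+ k %| a)%Z && (2 ^+ k %| v)%Z.
Proof. by rewrite /divpow exprS subrK !dvdz_mul2l. Qed.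

Lemma expn2_unbounded (m : int) : m != 0 -> exists k, ~~ (2 ^+ k %| m)%Z.
Proof.
move=> hm; exists `|m|%N; apply/negP; rewrite dvdzE abszX => /dvdn_leq.
by rewrite absz_gt0 hm leqNgt ltn_expl // => /(_ isT).
Qed.

Lemma divpow_unbounded (u v : int) : (u != 0) || (v != 0) ->
  exists k, ~~ divpow k u v.
Proof.
have [->|/expn2_unbounded[k hk] _] := eqVneq v 0.
  rewrite orbF => /expn2_unbounded[k hk].
  by exists k; rewrite /divpow addr0 negb_and hk.
by exists k.+1; rewrite /divpow negb_and exprS [X in _ || ~~ X]dvdz_mul2l // hk orbT.
Qed.

Lemma dvdz3_pow2 (k : nat) (v : int) : (2 ^+ k %| 3 * v)%Z = (2 ^+ k %| v)%Z.
Proof. by rewrite Gauss_dvdzr // coprimezXl. Qed.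

(* The products of 2 (u + v sqrt(-3)) with the three cube roots of unity are, up
   to sign, 2 (y + t sqrt(-3)); if all three t were congruent modulo 2 ^ k, then
   u + v sqrt(-3) would be divisible by 2 ^ (k + 1). *)
Lemma turn_second (k : nat) (w u v : int) : (2 %| u + v)%Z ->
  ~~ divpow k.+1 u v ->
  exists y t, eis (2 * y) (2 * t) = eis (2 * u) (2 * v) /\ ~~ (2 ^+ k %| w + t)%Z.
Proof.
move=> /even_subr[a ->]; rewrite divpowS => h.
have [h1|h1] := boolP (2 ^+ k %| w + v)%Z; last by exists (2 * a - v), v.
have [h2|h2] := boolP (2 ^+ k %| w + (a - v))%Z; last first.
  by exists (a + v), (a - v); split=> //; rewrite /eis; ring.
have [h3|h3] := boolP (2 ^+ k %| w + a)%Z; last first.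
  by exists (2 * v - a), a; split=> //; rewrite /eis; ring.
case/negP: h; have hv : (2 ^+ k %| v)%Z.
  by have := rpredB h3 h2; congr (_ %| _)%Z; ring.
rewrite hv andbT; have := rpredD (rpredB h3 h1) hv; congr (_ %| _)%Z; ring.
Qed.

(** As for [turn_second], except that [h2] and [h3] differ by [3 * v], where 3 is prime to 2. *)
Lemma turn_first (k : nat) (w u v : int) : (2 %| u + v)%Z ->
  ~~ divpow k.+1 u v ->
  exists y t, eis (2 * y) (2 * t) = eis (2 * u) (2 * v) /\ ~~ (2 ^+ k %| y + w)%Z.
Proof.
move=> /even_subr[a ->]; rewrite divpowS => h.
have [h1|h1] := boolP (2 ^+ k %| 2 * a - v + w)%Z; last by exists (2 * a - v), v.
have [h2|h2] := boolP (2 ^+ k %| a + v + w)%Z; last first.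
  by exists (a + v), (a - v); split=> //; rewrite /eis; ring.
have [h3|h3] := boolP (2 ^+ k %| a - 2 * v + w)%Z; last first.
  by exists (a - 2 * v), a; split=> //; rewrite /eis; ring.
case/negP: h; have hv : (2 ^+ k %| v)%Z.
  by rewrite -dvdz3_pow2; have := rpredB h2 h3; congr (_ %| _)%Z; ring.
rewrite hv andbT.
have := rpredD (rpredB h1 h2) (rpredD hv hv); congr (_ %| _)%Z; ring.
Qed.

Lemma turn_coprime3 (u v : int) : ~~ (3 %| u)%Z -> exists y t,
  [/\ eis y t = eis (2 * u) (2 * v), (2 %| y - (u + v))%Z, (2 %| t - (u + v))%Z
    & ~~ (3 %| t)%Z].
Proof.
move=> hu; have [h3|h3] := boolP (3 %| u + v)%Z.
  by exists (u + 3 * v), (u - v); rewrite eis_turn2; split=> //; lia.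
by exists (u - 3 * v), (u + v); rewrite eis_turn2N; split=> //; lia.
Qed.

(** A turn and an exchange replace [(u, v)] by [(x, t)], lowering the bound [k] by one. Once [u + v]
    is odd, one more turn makes [y] and [t] odd, and the exchange puts [y] beside the odd [z]. *)
Lemma good_odd_second (k : nat) (x z u v : int) : ~~ (2 %| z)%Z ->
  ~~ divpow k u v ->
  ((eis (2 * x) z + eis (2 * u) (2 * v)) %% 3 = 2)%Z ->
  good (eis (2 * x) z + eis (2 * u) (2 * v)).
Proof.
move=> hz; elim: k x u v => [|k IHk] x u v hk h; first by rewrite divpow0 in hk.
have [huv|huv] := boolP (2 %| u + v)%Z.
  have [y [t [e ht]]] := turn_second x huv hk.
  move: h; rewrite -e eis_swap [eis _ _ + _]addrC => h.
  by apply: IHk => //; rewrite /divpow negb_and ht.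
have [_ h2u] := sum_eis_mod3 h.
have [|y [t [e hy _ ht]]] := @turn_coprime3 u v; first by lia.
by move: h; rewrite -e eis_swap => h; apply: good_odd => //; lia.
Qed.

Lemma good_odd_even (x z u v : int) : (2 %| z)%Z ->
  (2 %| u + v)%Z -> ((eis x z + eis (2 * u) (2 * v)) %% 3 = 2)%Z ->
  good (eis x z + eis (2 * u) (2 * v)).
Proof.
move=> hz huv h; have [_ h2u] := sum_eis_mod3 h.
have [|y [t [e hy _ ht]]] := @turn_coprime3 u v; first by lia.
by move: h; rewrite -e eis_swap => h; apply: good_odd => //; lia.
Qed.

Lemma eisNl (x z : int) : eis (- x) z = eis x z.
Proof. by rewrite /eis sqrrN. Qed.

(* Turn the second summand, exchange, and turn back the summand that becomes
   divisible by 4. *)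
Lemma eis_move (a z u v : int) :
  eis (4 * a + (u - v)) (2 * z) + eis (2 * u) (2 * v)
  = eis (u + 3 * v) (2 * z) + eis (2 * (a + u - v)) (2 * a).
Proof. by rewrite /eis; ring. Qed.

Lemma eis_sign4 (x t : int) : ~~ (2 %| x)%Z -> ~~ (2 %| t)%Z ->
  exists a, forall z, eis x z = eis (4 * a + t) z.
Proof.
move=> hx ht; have [h|h] := boolP (4 %| x - t)%Z.
  by exists ((x - t) %/ 4)%Z => z; congr eis; lia.
by exists ((- x - t) %/ 4)%Z => z; rewrite -eisNl; congr eis; lia.
Qed.

Lemma good_odd_first0 (x z u v : int) : ~~ (2 %| x)%Z -> (2 %| u)%Z ->
  ~~ (2 %| v)%Z -> ((eis x (2 * z) + eis (2 * u) (2 * v)) %% 3 = 2)%Z ->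
  good (eis x (2 * z) + eis (2 * u) (2 * v)).
Proof.
move=> hx hu hv.
have [|a e] := @eis_sign4 x (u - v) hx; first by lia.
rewrite {}e => h; have [_ h2u] := sum_eis_mod3 h.
have [c ec] : exists c, u = 2 * c by exists (u %/ 2)%Z; lia.
have [ha|ha] := boolP (3 %| a)%Z.
  (* Changing the signs of the first coordinate and of [v] before the move gives [- (a + c)] in
     place of [a]. As [u = 2 * c] is prime to 3, so is one of the two. *)
  have e : eis (4 * a + (u - v)) (2 * z) + eis (2 * u) (2 * v)
     = eis (u + 3 * - v) (2 * z) + eis (2 * (- (a + c) + u - - v)) (2 * - (a + c)).
    by rewrite /eis ec; ring.
  by move: h; rewrite e eis_swap => h; apply: good_odd => //; lia.
by move: h; rewrite eis_move eis_swap => h; apply: good_odd => //; lia.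
Qed.

(* Induction on the 2-adic valuation of v: the two available moves produce new
   values of v whose difference is half the old one. *)
Lemma good_odd_first (k : nat) (x z u v : int) : ~~ (2 %| x)%Z ->
  ~~ (2 %| u + v)%Z -> ~~ (2 ^+ k.+1 %| v)%Z ->
  ((eis x (2 * z) + eis (2 * u) (2 * v)) %% 3 = 2)%Z ->
  good (eis x (2 * z) + eis (2 * u) (2 * v)).
Proof.
elim: k x u v => [|k IHk] x u v hx huv hv.
  by rewrite expr1 in hv; apply: good_odd_first0 => //; lia.
have [/dvdzP[c ec]|v1] := boolP (2 %| v)%Z; last by apply: good_odd_first0 => //; lia.
have [|a e] := @eis_sign4 x (u - v) hx; first by lia.
rewrite {}e => h.
have [ha|ha] := boolP (2 ^+ k.+1 %| a)%Z; last first.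
  by move: h; rewrite eis_move => h; apply: IHk => //; lia.
have e : eis (4 * a + (u - v)) (2 * z) + eis (2 * u) (2 * v)
    = eis (u + 3 * - v) (2 * z) + eis (2 * ((a - c) + u - - v)) (2 * (a - c)).
  by rewrite /eis ec; ring.
move: h; rewrite e => h; apply: IHk => //; [lia | lia | ].
apply: contra hv => hb; rewrite ec exprSr dvdz_mul2r //.
by have := rpredB ha hb; congr (_ %| _)%Z; ring.
Qed.

Lemma expn2S_ndvd (k : nat) (v : int) :
  ~~ (2 ^+ k %| v)%Z -> ~~ (2 ^+ k.+1 %| v)%Z.
Proof. by apply: contra; apply: dvdz_trans; rewrite exprS dvdz_mull. Qed.

Lemma good_odd_case (x z y t : int) : ~~ (2 %| x + z)%Z -> (2 %| y + t)%Z ->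
  ((eis x z + eis y t) %% 3 = 2)%Z ->
  good (eis x z + eis y t) \/ exists m, eis x z + eis y t = 5 * m ^+ 2.
Proof.
move=> hxz /eis_even[u [v ->]] h; have [hx h2u] := sum_eis_mod3 h.
have u0 : u != 0 by lia.
have [hz|hz] := boolP (2 %| z)%Z; last first.
  have [c ec] : exists c, x = 2 * c by exists (x %/ 2)%Z; lia.
  have [|k hk] := @divpow_unbounded u v; first by rewrite u0.
  by left; move: h; rewrite ec => h; apply: good_odd_second hk h.
have [huv|huv] := boolP (2 %| u + v)%Z; first by left; apply: good_odd_even.
have [c ec] : exists c, z = 2 * c by exists (z %/ 2)%Z; lia.
have hx2 : ~~ (2 %| x)%Z by lia.
move: h; rewrite ec => h.
have [v0|/expn2_unbounded[k hk]] := eqVneq v 0; last first.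
  left; apply: (good_odd_first (k := k)) => //.
  exact: expn2S_ndvd.
have [c0|/expn2_unbounded[k hk]] := eqVneq c 0; last first.
  left; move: h; rewrite eis_swap => h.
  have [huc|huc] := boolP (2 %| u + c)%Z; first by apply: good_odd_even => //; lia.
  apply: (good_odd_first (k := k)) => //.
  exact: expn2S_ndvd.
move: h; rewrite v0 c0.
have [|a e] := @eis_sign4 x (u - 0) hx2; first by lia.
rewrite !e => h.
have [a0|/expn2_unbounded[k hk]] := eqVneq a 0.
  (* With [v], [c] and [a] all zero, the summands are [u ^ 2] and [(2 * u) ^ 2]. *)
  by right; exists u; rewrite a0 /eis; ring.
left; move: h; rewrite eis_move => h; apply: (good_odd_first (k := k)) => //; try lia.
exact: expn2S_ndvd.
Qed.

(** * Doubled sums *)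

(* Uses 2 (|p|^2 + |q|^2) = |p - q|^2 + |p + q|^2, after multiplying p by a cube
   root of unity so that p - q and p + q both have good second coordinates. *)
Lemma good_double0 (x z y t : int) : ~~ (3 %| x)%Z -> (2 %| x + z)%Z ->
  good (2 * (eis x z + eis y t)).
Proof.
move=> hx hxz; have [r hr] : exists r, ~~ (3 %| r - t)%Z /\ ~~ (3 %| r + t)%Z.
  by have [ht|ht] := boolP (3 %| t)%Z; [exists 1; split; lia | exists 0; split; lia].
have [x' [z' [<- _ hz']]] := eis_residue r hxz hx.
exists (x' - y), (z' - t), (x' + y), (z' + t); split; [rewrite /eis; ring | lia | lia].
Qed.

(** Here the exchange produces the pair [(y, z)], so the turn has to control the first coordinate.
    Once [u + v] is odd, a turn puts the odd [u - v] beside the odd [x]. *)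
Lemma good_double_pow (k : nat) (x z u v : int) : ~~ (3 %| x)%Z ->
  ~~ (2 %| x)%Z -> ~~ divpow k u v ->
  good (2 * (eis x (2 * z) + eis (2 * u) (2 * v))).
Proof.
move=> h3x h2x; elim: k z u v => [|k IHk] z u v hk; first by rewrite divpow0 in hk.
have [huv|huv] := boolP (2 %| u + v)%Z.
  have [y [t [<- ht]]] := turn_first z huv hk.
  by rewrite eis_swap; apply: IHk; rewrite /divpow negb_and ht.
by rewrite eis_turn2 eis_swap; apply: good_double0 => //; lia.
Qed.

Lemma good_double (x z y t : int) : ~~ (3 %| x)%Z ->
  (2 %| x + z)%Z (+) (2 %| y + t)%Z -> (z != 0) || (y != 0) || (t != 0) ->
  good (2 * (eis x z + eis y t)).
Proof.
move=> h3x; have [hxz _ _|hxz /eis_even[u [v e]] hn] := boolP (2 %| x + z)%Z.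
  exact: good_double0.
have {}hn : (z != 0) || (u != 0) || (v != 0).
  case/orP: hn => [/orP[->//|hn]|hn]; rewrite -orbA; apply/orP; right.
    by move: e; rewrite /eis; nia.
  by move: e; rewrite /eis; nia.
rewrite {}e; have [hz|hz] := boolP (2 %| z)%Z; last first.
  by rewrite eis_swap; apply: good_double0 => //; lia.
have [c ec] : exists c, z = 2 * c by exists (z %/ 2)%Z; lia.
have [/andP[/eqP u0 /eqP v0]|] := boolP ((u == 0) && (v == 0)); last first.
  rewrite negb_and => /divpow_unbounded[k hk].
  by rewrite ec; apply: good_double_pow hk => //; lia.
move: hn; rewrite u0 v0 => hn.
have [|k hk] := @divpow_unbounded 0 c; first by lia.
by rewrite ec eis_swap; apply: good_double_pow hk => //; lia.
Qed.

(** * Every positive integer is a sum of two Eisenstein norms *)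

(** The norm of [a + b zeta], with [zeta] a primitive sixth root of unity. *)
Definition loe (a b : int) : int := a ^+ 2 + a * b + b ^+ 2.

Definition sum_loe (N : int) : Prop :=
  exists a b c d : int, loe a b + loe c d = N.

(* Multiplicativity of the reduced norm of the quaternion order
   Z[zeta] + Z[zeta] i, where zeta ^ 2 = zeta - 1 and i ^ 2 = -1. *)
Lemma loe_mul (a b c d p q r s : int) :
  (loe a b + loe c d) * (loe p q + loe r s) =
  loe (a * p + a * q + b * q + (c * r + c * s + d * s))
      (b * p - a * q + (d * r - c * s))
  + loe (c * p - d * q - (a * r - b * s))
        (c * q + d * p + d * q - (a * s + b * r + b * s)).
Proof. by rewrite /loe; ring. Qed.

Lemma sum_loeM (M N : int) : sum_loe M -> sum_loe N -> sum_loe (M * N).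
Proof.
move=> [a [b [c [d <-]]]] [p [q [r [s <-]]]].
by rewrite loe_mul; do 4!eexists.
Qed.

Lemma loe_ge0 (a b : int) : 0 <= loe a b.
Proof. by rewrite /loe; nia. Qed.

Lemma loe_eq0 (a b : int) : loe a b = 0 -> a = 0 /\ b = 0.
Proof. by rewrite /loe; nia. Qed.

Lemma centered_mod (m a : int) : 0 < m ->
  exists q, - m <= 2 * (a - m * q) <= m.
Proof. by move=> hm; exists ((2 * a + m) %/ (2 * m))%Z; nia. Qed.

(** [4 * loe c d = (2 * c + d) ^ 2 + 3 * d ^ 2]. Since 7/16 < 1/2, two such remainders have norms
    adding up to less than [m ^ 2]. *)
Lemma loe_reduce (m a b : int) : 0 < m ->
  exists p q, 16 * loe (a - m * p) (b - m * q) <= 7 * m ^+ 2.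
Proof.
move=> hm; have [q hq] := centered_mod b hm.
have [p hp] : exists p, - m <= 2 * (a - m * p) + (b - m * q) <= m.
  by exists ((2 * a + (b - m * q) + m) %/ (2 * m))%Z; nia.
exists p, q; move: hp hq; rewrite /loe.
set c := a - _; set d := b - _ => hp hq.
have : (2 * c + d) ^+ 2 <= m ^+ 2 by nia.
have : (2 * d) ^+ 2 <= m ^+ 2 by nia.
lia.
Qed.

Lemma sum_loe_descent (m N : int) : 0 < m -> sum_loe (m * N) ->
  (m %| N)%Z \/ exists m', [/\ 0 < m', m' < m & sum_loe (m' * N)].
Proof.
move=> hm [a [b [c [d e]]]].
have [p [q h1]] := loe_reduce a b hm; have [r [s h2]] := loe_reduce c d hm.
have [m' em] : exists m', loe (a - m * p) (b - m * q) + loe (c - m * r) (d - m * s) = m * m'.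
  exists (N - (2 * a * p + a * q + b * p + 2 * b * q + (2 * c * r + c * s + d * r + 2 * d * s))
   + m * (loe p q + loe r s)).
  by rewrite mulrDr mulrBr -e /loe; ring.
have := loe_ge0 (a - m * p) (b - m * q); have := loe_ge0 (c - m * r) (d - m * s).
have [m0|m0] := eqVneq m' 0 => h3 h4.
  have [] := @loe_eq0 (a - m * p) (b - m * q); first by lia.
  have [] := @loe_eq0 (c - m * r) (d - m * s); first by lia.
  move=> e1 e2 e3 e4; left; apply/dvdzP; exists (loe p q + loe r s).
  have hm0 : m != 0 by lia.
  apply: (mulfI hm0); rewrite -e.
  have -> : a = m * p by lia.
  have -> : b = m * q by lia.
  have -> : c = m * r by lia.
  have -> : d = m * s by lia.
  by rewrite /loe; ring.
right; exists m'; split; [nia | nia |].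
(* With [alpha] = (a, b, c, d), [kappa] = (p, q, r, s) and [beta = alpha - m kappa], these are the
   coordinates of [alpha conj(beta) / m = N - alpha conj(kappa)]. *)
exists (N - (a * p + a * q + b * q + (c * r + c * s + d * s))).
exists (- (b * p - a * q + (d * r - c * s))).
exists (a * r - b * s - (c * p - d * q)), (a * s + b * r + b * s - (c * q + d * p + d * q)).
have hm0 : m ^+ 2 != 0 by rewrite expf_neq0 //; lia.
apply: (mulfI hm0).
have -> : m ^+ 2 * (m' * N) = (m * N) * (m * m') by ring.
rewrite -em -e loe_mul.
set A := N - _; set B := - _.
have eA : m * A = loe a b + loe c d - m * (a * p + a * q + b * q + (c * r + c * s + d * s)).
  by rewrite /A mulrBr e.
have -> x y z t : m ^+ 2 * (loe x y + loe z t) = loe (m * x) (m * y) + loe (m * z) (m * t).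
  by rewrite /loe; ring.
by rewrite eA /B /loe; ring.
Qed.

Lemma sqr_Fp_inj (p : nat) (i j : 'I_(p./2.+1)) : prime p -> odd p ->
  (i%:R ^+ 2 : 'F_p) = j%:R ^+ 2 -> i = j.
Proof.
move=> pr_p odd_p /eqP; have hi := ltn_ord i; have hj := ltn_ord j.
have := odd_double_half p; rewrite odd_p => hp.
rewrite eqf_sqr => /orP[/eqP/(congr1 val)|].
  by rewrite /= !val_Fp_nat // !modn_small; [move/val_inj | lia | lia].
rewrite -subr_eq0 opprK -natrD -(dvdn_pcharf (pchar_Fp pr_p)) => hd.
have : (i + j < p)%N by lia.
have [/eqP|ij0 hlt] := posnP (i + j)%N.
  by rewrite addn_eq0 => /andP[/eqP i0 /eqP j0] _; apply: val_inj; rewrite /= i0 j0.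
by have := dvdn_leq ij0 hd; lia.
Qed.

(** Pigeonhole: [f] and [g] each take [(p + 1) / 2] values among [p]. *)
Lemma sum_sqr_3sqr_Fp (p : nat) : prime p -> odd p -> p != 3%N ->
  exists x y : 'F_p, x ^+ 2 + 3 * y ^+ 2 + 1 = 0.
Proof.
move=> pr_p odd_p p3.
pose f (i : 'I_(p./2.+1)) : 'F_p := i%:R ^+ 2.
pose g (i : 'I_(p./2.+1)) : 'F_p := - 1 - 3 * i%:R ^+ 2.
have f_inj : injective f by move=> i j; apply: sqr_Fp_inj.
have h3 : (3 : 'F_p) != 0.
  by rewrite -(dvdn_pcharf (pchar_Fp pr_p)) dvdn_prime2.
have g_inj : injective g.
  by move=> i j /addrI/oppr_inj/(mulfI h3); apply: sqr_Fp_inj.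
have : ~~ [disjoint codom f & codom g].
  apply/negP; rewrite disjoint_subset => /subset_leq_card.
  move/(leq_add (leqnn #|codom g|)); rewrite cardC !card_codom // !card_ord.
  by rewrite Fp_cast //; have := odd_double_half p; rewrite odd_p; lia.
case/pred0Pn => s /andP[/codomP[i ->] /codomP[j e]].
exists i%:R, j%:R; rewrite -/(f i) e /g; ring.
Qed.

Lemma sum_loe_prime (p : nat) : prime p -> sum_loe p%:Z.
Proof.
move=> pr_p; have [->|p2] := eqVneq p 2%N; first by exists 1, 0, 1, 0.
have [->|p3] := eqVneq p 3%N; first by exists 1, 1, 0, 0.
have odd_p : odd p by apply/negPn; apply: contra p2 => /(prime_oddPn pr_p)->.
have p_gt0 : 0 < p%:Z by have := prime_gt0 pr_p; lia.
have [m [m_gt0 ltmp hm]] : exists m, [/\ 0 < m, m < p%:Z & sum_loe (m * p%:Z)].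
  have [x [y e]] := sum_sqr_3sqr_Fp pr_p odd_p p3.
  have [n en] : exists n : nat, ((val x) ^ 2 + 3 * (val y) ^ 2 + 1 = n * p)%N.
    apply/dvdnP; rewrite (dvdn_pcharf (pchar_Fp pr_p)) !natrD natrM !natrX.
    by apply/eqP; rewrite !natr_Zp -[RHS]e; ring.
  (* Chosen so that [loe a b] is [x ^ 2 + 3 * y ^ 2]. *)
  pose a := (val x)%:Z - (val y)%:Z; pose b := 2 * (val y)%:Z.
  have {}en : loe a b + 1 = n%:Z * p%:Z.
    by rewrite -PoszM -en /loe /a /b; lia.
  have [q [r h]] := loe_reduce a b p_gt0.
  have em : loe (a - p%:Z * q) (b - p%:Z * r) + loe 1 0 =
    (n%:Z - (2 * a * q + a * r + b * q + 2 * b * r) + p%:Z * loe q r) * p%:Z.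
    by rewrite mulrDl mulrBl -en /loe; ring.
  move: h em (loe_ge0 (a - p%:Z * q) (b - p%:Z * r)).
  set L := loe _ _; set m := _ + p%:Z * loe q r => h em L_ge0.
  have e1 : loe 1 0 = 1 by [].
  have p_gt1 : 1 < p%:Z by have := prime_gt1 pr_p; lia.
  exists m; split; last by rewrite -em; do 4!eexists.
    by rewrite -(pmulr_lgt0 _ p_gt0) -em e1; lia.
  by rewrite -(ltr_pM2r p_gt0) -em e1; nia.
have [k] := ubnP `|m|%N; elim: k m m_gt0 ltmp hm => // k IHk m m_gt0 ltmp hm lek.
have [hd|[m' [m'_gt0 ltm' hm']]] := sum_loe_descent m_gt0 hm; last first.
  by apply: IHk hm' _ => //; lia.
suff m1 : m = 1 by rewrite m1 mul1r in hm.
move: hd; rewrite dvdzE /= => /(primeP pr_p).2/orP[]; lia.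
Qed.

Lemma sum_loe_nat (n : nat) : (0 < n)%N -> sum_loe n%:Z.
Proof.
elim/ltn_ind: n => n IHn n_gt0.
have [n1|n1] := leqP n 1.
  have -> : n = 1%N by lia.
  by exists 1, 0, 0, 0.
have /dvdnP[k ek] := pdiv_dvd n; have pr_p := pdiv_prime n1.
rewrite ek PoszM; apply: sum_loeM (sum_loe_prime pr_p).
have := prime_gt1 pr_p; move: ek; set p := pdiv n => ek hp.
by apply: IHn; nia.
Qed.

(** * Back to sums of two values of [eis] *)

(** Every Eisenstein integer has an associate in [Z[sqrt(-3)]]. *)
Lemma loe_eis (a b : int) : exists x z, loe a b = eis x z.
Proof.
have e2 c d : loe c (2 * d) = eis (c + d) d by rewrite /loe /eis; ring.
have [/dvdzP[c ->]|hb] := boolP (2 %| b)%Z.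
  by exists (a + c), c; rewrite -e2 mulrC.
have [/dvdzP[c ->]|ha] := boolP (2 %| a)%Z.
  by exists (b + c), c; rewrite -e2 /loe; ring.
have [c ->] : exists c, a = 2 * c - b by exists ((a + b) %/ 2)%Z; lia.
by exists (b - c), c; rewrite /loe /eis; ring.
Qed.

Lemma sum_eis_nat (n : nat) : (0 < n)%N ->
  exists x z y t, eis x z + eis y t = n%:Z.
Proof.
move=> /sum_loe_nat[a [b [c [d <-]]]].
have [x [z ->]] := loe_eis a b; have [y [t ->]] := loe_eis c d.
by exists x, z, y, t.
Qed.

Lemma eis_dvd2 (x z : int) : (2 %| eis x z)%Z = (2 %| x + z)%Z.
Proof.
have [/even_subr[a ->]|h] := boolP (2 %| x + z)%Z; first by rewrite /eis; lia.
have [|a e] := @even_subr (x - 1) z; first by lia.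
have -> : x = 2 * a + 1 - z by lia.
by rewrite /eis; lia.
Qed.

(** If [X] is a sum of two squares, one of them is [(2 * y') ^ 2 = y' ^ 2 + 3 * y' ^ 2]. *)
Lemma sum_eis_not_square (X : nat) : odd X ->
  (exists m : nat, X = (m ^ 2)%N) \/
  exists a b c d, eis a c + eis b d = X%:Z /\ (c != 0) || (d != 0).
Proof.
move=> odd_X; have [|x [z [y [t e]]]] := @sum_eis_nat X; first by lia.
have [/andP[/eqP z0 /eqP t0]|] := boolP ((z == 0) && (t == 0)); last first.
  by rewrite negb_and => hn; right; exists x, y, z, t.
have [x' [y' e']] : exists x' y', eis x' 0 + eis (2 * y') 0 = X%:Z.
  have [/dvdzP[y' ey]|hy] := boolP (2 %| y)%Z.
    by exists x, y'; rewrite -e z0 t0 ey mulrC.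
  have [|x' ex] := @even_subr x z.
    by have := eis_dvd2 x z; have := eis_dvd2 y t; lia.
  by exists y, x'; rewrite -e z0 t0 ex z0 addrC subr0.
have [y0|y0] := eqVneq y' 0.
  by left; exists `|x'|%N; move: e'; rewrite y0 /eis; lia.
right; exists x', y', 0, y'; split; last by rewrite y0 orbT.
by rewrite -e' /eis; ring.
Qed.

(** * The exceptional values [2 * X ^ 2] and [5 * X ^ 2] *)

Lemma good_mul_sqr (k : int) (X : nat) :
  (forall a b c d n : int, eis a c + eis b d = n -> ~~ (2 %| n)%Z ->
     ~~ (3 %| n)%Z -> (c != 0) || (d != 0) -> good (k * n ^+ 2)) ->
  odd X -> ~~ (3 %| X)%N -> (1 < X)%N -> good (k * X%:Z ^+ 2).
Proof.
move=> hk; elim/ltn_ind: X => X IHX odd_X h3 X_gt1.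
have [[m em]|[a [b [c [d [e hcd]]]]]] := sum_eis_not_square odd_X; last first.
  by apply: hk e _ _ hcd; lia.
have h3m : ~~ (3 %| m)%N by apply: contra h3; rewrite em => /dvdn_mulr; apply.
have -> : k * X%:Z ^+ 2 = m%:Z ^+ 2 * (k * m%:Z ^+ 2) by rewrite em; ring.
apply: good_scale; first by lia.
apply: IHX => //; [nia | | nia].
by move: odd_X; rewrite em oddX.
Qed.

(** The product [(a + b i) (c + d i)] is nonzero: [a = b = 0] would make the sum divisible by 3. *)
Lemma gauss_mul_neq0 (a b c d : int) : ~~ (3 %| eis a c + eis b d)%Z ->
  (c != 0) || (d != 0) -> (a * c - b * d != 0) || (a * d + b * c != 0).
Proof.
move=> h3 hcd; rewrite -negb_and; apply/negP => /andP[/eqP e1 /eqP e2].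
have : (a ^+ 2 + b ^+ 2) * (c ^+ 2 + d ^+ 2) == 0.
  have -> : (a ^+ 2 + b ^+ 2) * (c ^+ 2 + d ^+ 2)
    = (a * c - b * d) ^+ 2 + (a * d + b * c) ^+ 2 by ring.
  by rewrite e1 e2.
rewrite mulf_eq0 => /orP[] /eqP h; last by move: hcd; nia.
by move: h3; rewrite /eis; lia.
Qed.

(* For n = |al|^2 + 3 |be|^2 with Gaussian integers al = a + b i, be = c + d i,
   one has n^2 = (|al|^2 - 3 |be|^2)^2 + 12 |al be|^2, a representation to which
   the descent applies when be != 0. *)
Lemma good_2sqr (X : nat) : odd X -> ~~ (3 %| X)%N -> (1 < X)%N ->
  good (2 * X%:Z ^+ 2).
Proof.
apply: good_mul_sqr => a b c d n e h2 h3 hcd.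
have := @gauss_mul_neq0 a b c d; rewrite e => /(_ h3 hcd) hef.
have -> : n ^+ 2 = eis (n - 6 * (c ^+ 2 + d ^+ 2)) (2 * (a * c - b * d))
                 + eis 0 (2 * (a * d + b * c)) by rewrite -e /eis; ring.
by apply: good_double; [lia | lia | lia].
Qed.

Lemma good_5sqr (X : nat) : odd X -> ~~ (3 %| X)%N -> (1 < X)%N ->
  good (5 * X%:Z ^+ 2).
Proof.
apply: good_mul_sqr => a b c d n e h2 h3 hcd.
have := @gauss_mul_neq0 a b c d; rewrite e => /(_ h3 hcd).
set f := a * c - b * d; set g := a * d + b * c => hfg.
pose m := n - 6 * (c ^+ 2 + d ^+ 2).
(* From [5 * n ^ 2 = n ^ 2 + 4 * n ^ 2], expanding only the last term by
   [n ^ 2 = m ^ 2 + 12 * (f ^ 2 + g ^ 2)]. *)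
have en : 5 * n ^+ 2 = eis n (2 * (2 * f)) + eis (2 * m) (2 * (2 * g)).
  by rewrite /m /f /g -e /eis; ring.
have hmod : ((5 * n ^+ 2) %% 3)%Z = 2.
  by have := eis_mod3 n 0; rewrite /eis; lia.
rewrite en in hmod *.
have [g0|g0] := eqVneq g 0; last first.
  have [|k hk] := @expn2_unbounded (2 * g); first by lia.
  apply: (good_odd_first (k := k)) => //; [rewrite /m; lia | exact: expn2S_ndvd].
have [|k hk] := @expn2_unbounded (2 * f); first by lia.
move: hmod; rewrite eis_swap => hmod.
apply: (good_odd_first (k := k)) => //; [rewrite /m; lia | exact: expn2S_ndvd].
Qed.

(** * Representation of [3 * n + 8] according to its residue modulo 4, and the theorem *)

Lemma good_3n8 (n : nat) : good (3 * n + 8)%:Z.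
Proof.
set N := (3 * n + 8)%N.
have [h4|h4] := boolP (4 %| N)%N.
  have [M eM] : exists M, N = (4 * M)%N by exists (N %/ 4)%N; lia.
  have [|x [z [y [t e]]]] := @sum_eis_nat M; first by lia.
  have e4 a b : eis (2 * a) (2 * b) = 4 * eis a b by rewrite /eis; ring.
  have -> : N%:Z = eis (2 * x) (2 * z) + eis (2 * y) (2 * t).
    by rewrite !e4 -mulrDr e eM PoszM.
  by apply: good_even; rewrite ?e4; lia.
have [h2|h2] := boolP (2 %| N)%N.
  have [M eM] : exists M, N = (2 * M)%N by exists (N %/ 2)%N; lia.
  have [x [z [y [t [e hx]]]]] : exists x z y t,
      eis x z + eis y t = M%:Z /\ ~~ (3 %| x)%Z.
    have [|x [z [y [t e]]]] := @sum_eis_nat M; first by lia.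
    have [hx|hx] := boolP (3 %| x)%Z; last by exists x, z, y, t.
    exists y, t, x, z; split; first by rewrite addrC.
    by have := eis_mod3 x z; have := eis_mod3 y t; lia.
  have -> : N%:Z = 2 * (eis x z + eis y t) by rewrite e eM PoszM.
  have hxor : (2 %| x + z)%Z (+) (2 %| y + t)%Z.
    have : ~~ (2 %| eis x z + eis y t)%Z by rewrite e; lia.
    by rewrite -(eis_dvd2 x z) -(eis_dvd2 y t); lia.
  have [|hn] := boolP ((z != 0) || (y != 0) || (t != 0)); first exact: good_double.
  move: hn; rewrite !negb_or !negbK => /andP[/andP[/eqP z0 /eqP y0] /eqP t0].
  have -> : eis x z + eis y t = (`|x|%N)%:Z ^+ 2.
    by rewrite z0 y0 t0 /eis; lia.
  have eMx : x ^+ 2 = M%:Z by rewrite -e z0 y0 t0 /eis; ring.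
  move: hxor; rewrite z0 y0 t0 !addr0 dvdz0 addbT => h2x.
  (* [2 * x ^ 2 = N >= 8] gives [|x| > 1]. *)
  by apply: good_2sqr; [lia | lia | nia].
have [x [z [y [t [e hxz]]]]] : exists x z y t,
      eis x z + eis y t = N%:Z /\ ~~ (2 %| x + z)%Z.
  have [|x [z [y [t e]]]] := @sum_eis_nat N; first by lia.
  have [hx|hx] := boolP (2 %| x + z)%Z; last by exists x, z, y, t.
  exists y, t, x, z; split; first by rewrite addrC.
  by have := eis_dvd2 x z; have := eis_dvd2 y t; lia.
have hyt : (2 %| y + t)%Z.
  by have := eis_dvd2 x z; have := eis_dvd2 y t; lia.
have hmod : ((eis x z + eis y t) %% 3)%Z = 2 by rewrite e; lia.
have [] := good_odd_case hxz hyt hmod; rewrite e // => -[m em].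
have eNm : N%:Z = 5 * `|m|%N%:Z ^+ 2 by lia.
rewrite eNm; apply: good_5sqr; [| |]; have h : ~~ (2 %| m)%Z by apply: contra h2; lia.
- by lia.
- by lia.
- by nia.
Qed.

Lemma sqr_P8 (x : int) : ~~ (3 %| x)%Z -> exists a, x ^+ 2 = 3 * P8 a + 1.
Proof.
move=> hx; have [a [->|->]] : exists a, x = 3 * a - 1 \/ x = - (3 * a - 1).
  have [h|h] := boolP (3 %| x + 1)%Z; first by exists ((x + 1) %/ 3)%Z; lia.
  by exists ((1 - x) %/ 3)%Z; lia.
- by exists a; rewrite /P8; ring.
- by exists a; rewrite /P8; ring.
Qed.

Theorem theorem2p1 :
  (forall n : nat, exists x y z t : int,
     P8 x + P8 y + 3 * P8 z + 3 * P8 t = n%:Z)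
  /\ universal [tuple 1; 1; 3; 3]%N.
Proof.
have main (n : nat) : exists x y z t : int,
    P8 x + P8 y + 3 * P8 z + 3 * P8 t = n%:Z.
  have [x [z [y [t [e hz ht]]]]] := good_3n8 n.
  have [|hx hy] := @sum_eis_mod3 x z y t; first by rewrite e; lia.
  have [[a ea] [b eb]] := (sqr_P8 hx, sqr_P8 hy).
  have [[c ec] [d ed]] := (sqr_P8 hz, sqr_P8 ht).
  by exists a, b, c, d; move: e; rewrite /eis ea eb ec ed; lia.
split=> // n; have [x [y [z [t <-]]]] := main n.
exists [tuple x; y; z; t].
by rewrite /Phi !big_ord_recl big_ord0 /= !(tnth_nth 0) /=; ring.
Qed.
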